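(* Let $n\ge 1$. There exists a listing $\pi_0,\pi_1,\ldots,\pi_{n!-1}$ of all permutations of $\{1,2,\ldots,n\}$ (written as words) such that consecutive permutations $\pi_i,\pi_{i+1}$ differ by interchanging the symbols in two adjacent positions, and $\pi_{i+n!/2}$ is the reversal of $\pi_i$ for all $0\le i<n!/2$, if and only if $n\le 4$ or $n\equiv 0,1 \pmod 4$.
   Context: The reversal of a word $a_1a_2\cdots a_n$ is $a_na_{n-1}\cdots a_1$. Such a listing is called a reverse (adjacent interchange) Gray code for permutations of $12\ldots n$. *)

(* Defs.v *)
From mathcomp Require Import all_boot.
Set Implicit Arguments. Unset Strict Implicit. Unset Printing Implicit Defensive.

Definition is_perm_word (n : nat) (w : seq nat) : Prop := perm_eq w (iota 1 n).

Definition adj_interchange (w w' : seq nat) : Prop :=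
  exists j, j.+1 < size w /\
    w' = set_nth 0 (set_nth 0 w j (nth 0 w j.+1)) j.+1 (nth 0 w j).

Definition reverse_gray_code (n : nat) (L : seq (seq nat)) : Prop :=
  [/\ size L = n`!, uniq L,
      (forall w, w \in L <-> is_perm_word n w),
      (forall i, i.+1 < size L -> adj_interchange (nth [::] L i) (nth [::] L i.+1))
    & (forall i, i < n`! %/ 2 -> nth [::] L (i + n`! %/ 2) = rev (nth [::] L i))].

(* Main.v *)
(** Adjacent interchanges flip the parity of the number of inversions, and
    reversal changes it by 'C(n, 2).  For n > 4 the half length n!/2 is even,
    so a listing forces 'C(n, 2) to be even, i.e. n = 0, 1 (mod 4).

    Conversely, exactly one of w and rev w has the letter 1 before the letter 2,
    so it suffices to find a Hamiltonian path, from 12...n to a neighbour of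
    n...21, in the graph of the words with 1 before 2; its reversal is the second
    half.  This graph is Hamilton-laceable: any two vertices of opposite parity
    are joined by a Hamiltonian path.  Split it into blocks by first letter; each
    block is a graph of the same kind on one letter less.  If the endpoints lie in
    different blocks, visit the blocks one after the other, passing from one to the
    next by an edge k l w -- l k w.  If both lie in block k, take a Hamiltonian
    path of the block and replace one of its edges k a b w -- k b a w by a detour
    from a k b w to b k a w through all other blocks.  The induction starts from
    all words on 4 letters and the words with 1 before 2 on 5 letters, where the
    paths are found by computation. *)

Require Import Defs.
From mathcomp Require Import all_boot.
From mathcomp Require Import zify.
From Corelib Require Import BinNums.
From Stdlib Require FMapPositive.
Set Implicit Arguments. Unset Strict Implicit. Unset Printing Implicit Defensive.

(** * Adjacent interchanges and the parity of inversions *)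

Notation word := (seq nat).

Fixpoint adj (u v : word) : bool :=
  match u, v with
  | a :: u', b :: v' =>
    if a == b then adj u' v' else
    match u', v' with
    | c :: u'', d :: v'' => [&& a == d, b == c & u'' == v'']
    | _, _ => false
    end
  | _, _ => false
  end.

Fixpoint odd_inv (w : word) : bool :=
  if w is a :: w' then odd (count (fun b => b < a) w') (+) odd_inv w' else false.

(** Stated by avoidance, so that it holds vacuously once 1 or 2 has left the alphabet. *)
Definition one_first (w : word) := ~~ subseq [:: 2; 1] w.

(** The linear extensions of the order on the letters of [T] whose only relation is 1 before 2. *)
Definition lin_ext (T : word) : pred word := [pred w | perm_eq w T && one_first w].

(* The letter q is 2 after relabelling: an edge a b w -- b a w can be used for
   a detour in the next larger graph only if a and b differ from 2, because
   1 a b w must be allowed to become a 1 b w. *)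
Definition same_head q (u v : word) :=
  [|| head 0 u == head 0 v, head 0 u == q | head 0 v == q].

Definition switches (q : nat) x p := ~~ path (same_head q) x p.

Definition ham_path (S : pred word) x y p :=
  [/\ path adj x p, last x p = y, uniq (x :: p) & x :: p =i S].

(** The condition [switches 2 x p] strengthens the induction: it supplies the edge at which a path
    inside one block can be opened for a detour. *)
Definition laceable (T : word) := forall x y, x \in lin_ext T -> y \in lin_ext T ->
  odd_inv x != odd_inv y -> exists p, ham_path (lin_ext T) x y p /\ switches 2 x p.

Lemma adjP u v : reflect
  (exists s a b t, [/\ a != b, u = s ++ a :: b :: t & v = s ++ b :: a :: t]) (adj u v).
Proof.
elim: u v => [|a u IH] [|b v] /=;
  try by apply: (iffP idP) => // -[[|? ?] [? [? [? []]]]].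
case: eqP => [<-|/eqP ab].
  apply: (iffP (IH v)) => -[s [c [d [t [cd Eu Ev]]]]].
    by exists (a :: s), c, d, t; rewrite Eu Ev.
  case: s Eu Ev => [|k s] /= [Ea Eu] [Eb Ev]; first by rewrite -Ea -Eb eqxx in cd.
  by exists s, c, d, t.
apply: (iffP idP) => [|[[|k s] [c [d [t [cd /= [Ea ->] [Eb ->]]]]]]].
- case: u {IH} => [|c u] //; case: v => [|d v] // /and3P[/eqP Ea /eqP Eb /eqP->].
  by exists [::], a, b, v; rewrite ab -Ea Eb.
- by rewrite Ea Eb !eqxx.
- by move: ab; rewrite Ea Eb eqxx.
Qed.

Lemma adj_cons k u v : adj (k :: u) (k :: v) = adj u v.
Proof. by rewrite /= eqxx. Qed.

Lemma adj_swap a b w : a != b -> adj (a :: b :: w) (b :: a :: w).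
Proof. by move=> /negbTE /= ->; rewrite !eqxx. Qed.

Lemma adj_sym : symmetric adj.
Proof.
move=> u v; apply/adjP/adjP => -[s [a [b [t [ab -> ->]]]]];
  by exists s, b, a, t; rewrite eq_sym ab.
Qed.

Lemma adj_rev u v : adj u v -> adj (rev u) (rev v).
Proof.
move=> /adjP[s [a [b [t [ab -> ->]]]]]; apply/adjP.
exists (rev t), b, a, (rev s); rewrite eq_sym ab; split=> //.
- by rewrite rev_cat !rev_cons -!cats1 -!catA.
- by rewrite rev_cat !rev_cons -!cats1 -!catA.
Qed.

Lemma adj_perm u v : adj u v -> perm_eq u v.
Proof.
move=> /adjP[s [a [b [t [ab -> ->]]]]].
by rewrite perm_cat2l (perm_catCA [:: a] [:: b] t).
Qed.

(** A first letter creates equally many inversions in front of two anagrams. *)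
Lemma odd_inv_cons k u v : perm_eq u v ->
  odd_inv (k :: u) (+) odd_inv (k :: v) = odd_inv u (+) odd_inv v.
Proof.
move=> /permP E; rewrite /= (E (fun b => b < k)).
by case: (odd _); case: (odd_inv u); case: (odd_inv v).
Qed.

Lemma odd_inv_swap a b w : a != b -> odd_inv (b :: a :: w) = ~~ odd_inv (a :: b :: w).
Proof.
rewrite neq_ltn /= !oddD; case/orP => [ab|ba].
  rewrite ab ltnNge (ltnW ab) /=.
  by case: (odd (count _ _)); case: (odd (count _ _)); case: (odd_inv w).
rewrite ba ltnNge (ltnW ba) /=.
by case: (odd (count _ _)); case: (odd (count _ _)); case: (odd_inv w).
Qed.

Lemma adj_odd_inv u v : adj u v -> odd_inv v = ~~ odd_inv u.
Proof.
move=> /adjP[s [a [b [t [ab -> ->]]]]].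
elim: s => [|k s IH]; first exact: odd_inv_swap.
have P : perm_eq (s ++ a :: b :: t) (s ++ b :: a :: t).
  by apply: adj_perm; apply/adjP; exists s, a, b, t.
have := odd_inv_cons k P; rewrite !cat_cons IH.
by case: (odd_inv _); case: (odd_inv _); case: (odd_inv _).
Qed.

(** * Words with 1 before 2, split by first letter *)

Lemma one_first_cons k w : k != 2 -> one_first (k :: w) = one_first w.
Proof.
rewrite /one_first -[subseq _ (k :: w)]/(subseq (if 2 == k then _ else _) w).
by rewrite eq_sym => /negbTE->.
Qed.

Lemma one_first_cons2 w : one_first (2 :: w) = (1 \notin w).
Proof. by rewrite /one_first -sub1seq. Qed.

Lemma one_first_swap a b w : ~~ ((a == 1) && (b == 2)) ->
  one_first (a :: b :: w) -> one_first (b :: a :: w).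
Proof.
have [->|a2] := eqVneq a 2; have [->|b2] := eqVneq b 2 => //.
- by rewrite one_first_cons2 inE negb_or one_first_cons // one_first_cons2 => _ /andP[].
- rewrite andbT => a1.
  by rewrite one_first_cons // !one_first_cons2 inE eq_sym (negbTE a1).
- by rewrite !one_first_cons.
Qed.

(** These are the minimal elements of the order, hence the possible first letters of its linear
    extensions. *)
Definition head_of (T : word) k := (k \in T) && ~~ ((k == 2) && (1 \in T)).

Lemma lin_ext_cons k w T :
  (k :: w \in lin_ext T) = head_of T k && (w \in lin_ext (rem k T)).
Proof.
rewrite !inE /head_of -andbA; case: (boolP (k \in T)) => [kT|kT] /=; last first.
  by apply/negbTE; apply: contra kT => /andP[/perm_mem <- _]; rewrite mem_head.
rewrite (perm_sym _ T) (permPl (perm_to_rem kT)) perm_cons perm_sym.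
have [k2|k2] /= := eqVneq k 2; last by rewrite one_first_cons.
rewrite k2 one_first_cons2; case P: (perm_eq w (rem 2 T)) => /=; last by rewrite andbF.
have E : (1 \in T) = (1 \in w).
  by rewrite (perm_mem P) (perm_mem (perm_to_rem (_ : 2 \in T))) -?k2 // inE k2.
rewrite E; case: (boolP (1 \in w)) => //= w1; symmetry; rewrite /one_first.
by apply: contra w1 => /mem_subseq -> //; rewrite !inE.
Qed.

Lemma lin_ext_perm u w T : perm_eq u w -> one_first w ->
  u \in lin_ext T -> w \in lin_ext T.
Proof.
move=> uw okw; rewrite !inE okw andbT => /andP[uT _].
by rewrite (perm_trans _ uT) // perm_sym.
Qed.

Lemma lin_ext_odd_inv k T u v : u \in lin_ext T -> v \in lin_ext T ->
  (odd_inv (k :: u) != odd_inv (k :: v)) = (odd_inv u != odd_inv v).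
Proof.
move=> /andP[uT _] /andP[vT _]; have := @odd_inv_cons k u v.
rewrite (perm_trans uT) 1?perm_sym // => /(_ isT).
by case: (odd_inv (k :: u)); case: (odd_inv (k :: v));
  case: (odd_inv u); case: (odd_inv v).
Qed.

(** * Composing Hamiltonian paths *)

Lemma ham_eq (S S' : pred word) x y p :
  S =i S' -> ham_path S x y p -> ham_path S' x y p.
Proof. by move=> E [? ? ? H]; split=> // w; rewrite H E. Qed.

Lemma ham_cat (S1 S2 : pred word) x u v y p q :
    (forall w, w \in S1 -> w \notin S2) -> adj u v ->
    ham_path S1 x u p -> ham_path S2 v y q ->
  ham_path [pred w | (w \in S1) || (w \in S2)] x y (p ++ v :: q).
Proof.
move=> D uv [adjp lastp uniqp Ep] [adjq lastq uniqq Eq]; split.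
- by rewrite cat_path adjp lastp /= uv.
- by rewrite last_cat.
- rewrite -cat_cons cat_uniq uniqp uniqq andbT andTb.
  by apply/hasPn => w; rewrite Eq => wS; rewrite Ep; apply: contraL wS; apply: D.
- by move=> w; rewrite -cat_cons mem_cat Ep Eq.
Qed.

Lemma switches_catl q x p v p' : switches q x p -> switches q x (p ++ v :: p').
Proof. by rewrite /switches cat_path; apply: contra => /andP[]. Qed.

Lemma switches_catr q x p v p' : switches q v p' -> switches q x (p ++ v :: p').
Proof. by rewrite /switches cat_path /=; apply: contra => /and3P[]. Qed.

Lemma switches_cat q x p v p' :
  ~~ same_head q (last x p) v -> switches q x (p ++ v :: p').
Proof. by rewrite /switches cat_path /=; apply: contra => /and3P[]. Qed.

Definition block (T : word) k : pred word :=
  [pred w | (w \in lin_ext T) && (head 0 w == k)].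

Lemma ham_block T k x y p : head_of T k -> ham_path (lin_ext (rem k T)) x y p ->
  ham_path (block T k) (k :: x) (k :: y) (map (cons k) p).
Proof.
move=> Tk [adjp lastp uniqp Ep]; split.
- by elim: p x adjp {lastp uniqp Ep} => //= z p IH x /andP[xz /IH->]; rewrite eqxx xz.
- by rewrite last_map lastp.
- by rewrite -map_cons map_inj_uniq // => u v [].
move=> w; rewrite -map_cons [w \in block _ _]inE; apply/mapP/andP => [[z]|].
  by rewrite Ep => zT ->; rewrite lin_ext_cons Tk zT eqxx.
case: w => [|a w] [wT /= /eqP E].
  by case/andP: wT => /perm_size/esym/size0nil T0; rewrite T0 in Tk.
by exists w; rewrite E in wT *; move: wT; rewrite ?Ep lin_ext_cons => /andP[].
Qed.

Lemma lin_ext_head T x : 0 < size T -> x \in lin_ext T ->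
  exists k x', [/\ x = k :: x', head_of T k & x' \in lin_ext (rem k T)].
Proof.
case: x => [|k x] T0 xT; last first.
  by exists k, x; split=> //; move: xT; rewrite lin_ext_cons => /andP[].
by move: xT T0; rewrite inE => /andP[/perm_size /= <-].
Qed.

(** * Visiting blocks one after the other *)

Lemma sorted_rem k T : sorted ltn T -> sorted ltn (rem k T).
Proof. by apply: subseq_sorted; [exact: ltn_trans | exact: rem_subseq]. Qed.

Lemma sorted_one_first T : sorted ltn T -> one_first T.
Proof.
move=> s; apply: contraTN (erefl true) => /subseq_sorted.
by move/(_ ltn ltn_trans s).
Qed.

(** The sorted word is even; interchanging its first two letters, or the second and third if the
    first two are 1 and 2, gives an odd one. *)
Lemma lin_ext_parity T b : sorted ltn T -> 2 < size T ->
  exists2 w, w \in lin_ext T & odd_inv w = b.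
Proof.
move=> sT; have okT := sorted_one_first sT.
have TV : T \in lin_ext T by rewrite inE perm_refl okT.
have parT : odd_inv T = false.
  elim: T sT {okT TV} => //= a T IH sT; rewrite (IH (path_sorted sT)) addbF.
  rewrite (_ : count _ _ = 0) //; apply/eqP; rewrite -leqn0 leqNgt -has_count.
  apply/hasPn => c cT; rewrite -leqNgt ltnW //.
  by move: sT; rewrite (path_sortedE ltn_trans) => /andP[/allP /(_ _ cT)].
case: b; last by exists T.
case: T sT okT TV parT => [|a [|b [|c T]]] //= /and3P[ab bc _] okT TV parT _.
have [/andP[/eqP a1 /eqP b2]|ne] := boolP ((a == 1) && (b == 2)).
  have A : adj [:: a, b, c & T] [:: a, c, b & T].
    by rewrite adj_cons adj_swap // neq_ltn bc.
  exists [:: a, c, b & T]; last by rewrite (adj_odd_inv A) /= parT.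
  apply: lin_ext_perm TV; first exact: adj_perm.
  rewrite one_first_cons ?a1 // one_first_swap // ?b2 //.
  by rewrite one_first_cons ?a1 in okT => //; rewrite b2 in okT.
have A : adj [:: a, b, c & T] [:: b, a, c & T] by rewrite adj_swap // neq_ltn ab.
exists [:: b, a, c & T]; last by rewrite (adj_odd_inv A) /= parT.
by apply: lin_ext_perm TV; [exact: adj_perm | exact: one_first_swap].
Qed.

(** An edge between two blocks fails to be a switch exactly when one of them is block 2; these are
    the chains of blocks in which no such edge counts. *)
Definition every_other_2 := path (fun a b : nat => (a == 2) || (b == 2)).

(** Consecutive blocks are joined by an edge k l w -- l k w whose common tail [w] can have either
    parity, so the two endpoints inside every block can be given opposite parities. *)
Lemma block_chain T k ks x y : sorted ltn T -> 4 < size T ->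
    uniq (k :: ks) -> (forall c, c \in k :: ks -> head_of T c /\ laceable (rem c T)) ->
    x \in block T k -> y \in block T (last k ks) -> odd_inv x != odd_inv y ->
  exists p, ham_path [pred w | (w \in lin_ext T) && (head 0 w \in k :: ks)] x y p /\
            (~~ every_other_2 k ks -> switches 2 x p).
Proof.
move=> sT T4; elim: ks k x => [|l ks IH] k x /= uk Hk.
  move=> xT yT xy; have [Tk lk] := Hk k (mem_head _ _).
  have T0 : 0 < size T by apply: leq_trans T4.
  case/andP: xT => /(lin_ext_head T0)[k1 [x' [Ex _ x'T]]]; rewrite Ex => /= /eqP Ek1.
  case/andP: yT => /(lin_ext_head T0)[k2 [y' [Ey _ y'T]]]; rewrite Ey => /= /eqP Ek2.
  subst k1 k2 x y.
  have [|p [hp _]] := lk x' y' x'T y'T.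
    by rewrite -(lin_ext_odd_inv k x'T y'T).
  exists (map (cons k) p); split=> //.
  by apply: ham_eq (ham_block Tk hp) => w; rewrite !inE.
move=> xT yT xy.
have [Tk lk] := Hk k (mem_head _ _).
have [Tl ll] : head_of T l /\ laceable (rem l T) by apply: Hk; rewrite !inE eqxx orbT.
move: uk; rewrite inE negb_or -andbA => /and3P[kl kks uk].
have [kT] := andP Tk; have [lT] := andP Tl => l2 k2.
have lrT : l \in rem k T.
  by rewrite mem_rem_uniq ?inE ?lT ?(eq_sym l) ?kl // (sorted_uniq ltn_trans ltnn).
(* At least three letters remain for [w], so both parities occur; the right one makes the exit of
   block [k] opposite to [x]. *)
have [w wT Pw] : exists2 w, w \in lin_ext (rem l (rem k T)) &
    odd_inv [:: k, l & w] = ~~ odd_inv x.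
  have R b : exists2 w, w \in lin_ext (rem l (rem k T)) & odd_inv w = b.
    apply: lin_ext_parity; first by do 2!apply: sorted_rem.
    by rewrite !size_rem //; move: T4; case: (size T) => [|[|]].
  have [w0 w0T P0] := R false; have [w1 w1T P1] := R true.
  have P : perm_eq w0 w1.
    by case/andP: w0T => A _; case/andP: w1T => B _; rewrite (perm_trans A) // perm_sym.
  have := @odd_inv_cons k (l :: w0) (l :: w1); rewrite perm_cons P => /(_ isT).
  rewrite (odd_inv_cons l P) P0 P1 => E.
  have [E0|E0] := eqVneq (odd_inv [:: k, l & w0]) (~~ odd_inv x); first by exists w0.
  exists w1 => //; move: E E0.
  by case: (odd_inv [:: k, l & w0]); case: (odd_inv [:: k, l & w1]); case: (odd_inv x).
have uT : [:: k, l & w] \in lin_ext T.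
  rewrite lin_ext_cons Tk lin_ext_cons wT /head_of lrT andbT /=.
  by apply: contra l2 => /andP[-> /mem_rem->].
have A : adj [:: k, l & w] [:: l, k & w] by rewrite adj_swap.
have vT : [:: l, k & w] \in lin_ext T.
  apply: lin_ext_perm (uT); first exact: adj_perm.
  (* The forbidden case k = 1, l = 2 does not occur, as 2 heads no word while 1 is in [T]. *)
  apply: one_first_swap; last by case/andP: uT.
  by apply: contra l2 => /andP[/eqP<- ->]; rewrite kT.
have [||//||q [hq Hq]] := IH l [:: l, k & w] uk.
- by move=> c cks; apply: Hk; rewrite inE cks orbT.
- by rewrite inE vT /= eqxx.
- by rewrite (adj_odd_inv A) Pw; case: (odd_inv x) xy; case: (odd_inv y).
have T0 : 0 < size T by apply: leq_trans T4.
case/andP: xT => /(lin_ext_head T0)[k1 [x' [Ex _ x'T]]]; rewrite Ex => /= /eqP Ek1.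
subst k1 x.
have wT' : l :: w \in lin_ext (rem k T) by move: uT; rewrite lin_ext_cons => /andP[].
have [|p [hp _]] := lk x' (l :: w) x'T wT'.
  by rewrite -(lin_ext_odd_inv k x'T wT') Pw; case: (odd_inv _).
exists (map (cons k) p ++ [:: l, k & w] :: q); split.
  have D z : z \in block T k ->
      z \notin [pred w0 | (w0 \in lin_ext T) && (head 0 w0 \in l :: ks)].
    by rewrite !inE => /andP[_ /eqP->]; rewrite (negbTE kl) (negbTE kks) andbF.
  apply: ham_eq (ham_cat D A (ham_block Tk hp) hq) => z.
  by rewrite !inE -andb_orr.
rewrite /every_other_2 /= negb_and => /orP[|/Hq]; last exact: switches_catr.
rewrite negb_or => /andP[n1 n2]; apply: switches_cat.
have [_ -> _ _] := ham_block Tk hp.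
by rewrite /same_head /= !negb_or kl n1 n2.
Qed.

(** * Detours and the inductive step *)

Lemma path_split (e : rel word) x p : ~~ path e x p ->
  exists p1 v p2, p = p1 ++ v :: p2 /\ ~~ e (last x p1) v.
Proof.
elim: p x => //= y p IH x; case: (boolP (e x y)) => [_ /IH|exy _].
  by case=> p1 [v [p2 [-> ev]]]; exists (y :: p1), v, p2.
by exists [::], y, p.
Qed.

Lemma adj_head u v : adj u v -> head 0 u != head 0 v ->
  exists a b w, [/\ a != b, u = [:: a, b & w] & v = [:: b, a & w]].
Proof.
case/adjP => -[|k s] [a [b [w [ab -> ->]]]]; first by exists a, b, w.
by rewrite /= eqxx.
Qed.

(** The edge from [last x p1] to [v] is cut, and the path through [S'] fills the gap. *)
Lemma ham_insert (S S' : pred word) x y p1 v p2 u' v' r :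
    (forall w, w \in S -> w \notin S') ->
    adj (last x p1) u' -> adj v' v ->
    ham_path S x y (p1 ++ v :: p2) -> ham_path S' u' v' r ->
  ham_path [pred w | (w \in S) || (w \in S')] x y (p1 ++ u' :: r ++ v :: p2).
Proof.
move=> D xu vv [adjp lastp uniqp Ep] [adjr lastr uniqr Er].
have P : perm_eq (x :: p1 ++ u' :: r ++ v :: p2) ((x :: p1 ++ v :: p2) ++ u' :: r).
  by rewrite /= perm_cons -catA perm_cat2l -cat_cons perm_catC.
split.
- move: adjp; rewrite !cat_path /= cat_path /= adjr lastr xu vv /=.
  by case/and3P => -> _ ->.
- by rewrite -lastp !last_cat /= last_cat.
- rewrite (perm_uniq P) cat_uniq uniqp uniqr andbT andTb.
  by apply/hasPn => w; rewrite Er => wS; rewrite Ep; apply: contraL wS; apply: D.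
- by move=> w; rewrite (perm_mem P) mem_cat Ep Er.
Qed.

(** At least four blocks have three junctions, and the letter 2, occurring at most once, takes part
    in at most two of them. *)
Lemma every_other_2_short k ks : uniq (k :: ks) -> 2 < size ks -> ~~ every_other_2 k ks.
Proof.
case: ks => [|a [|b [|c ks]]] // + _.
by rewrite /every_other_2 [uniq _]/= [path _ _ _]/= !inE; lia.
Qed.

Definition heads T := [seq c <- T | head_of T c].

(** Preceded by the head [a], this is a chain to the head [b] through all heads if k = a, and
    through all heads but [k] if [k] is neither [a] nor [b]. *)
Definition route T k a b :=
  rcons [seq c <- heads T | [&& c != a, c != b & c != k]] b.

Lemma route_uniq T k a b : uniq T -> a != b -> uniq (a :: route T k a b).
Proof.
move=> uT ab; rewrite /= rcons_uniq mem_rcons inE negb_or ab !mem_filter !eqxx andbF /=.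
by rewrite !filter_uniq.
Qed.

Lemma mem_route T k a b c : head_of T a -> head_of T b ->
  k = a \/ (k != a /\ k != b) ->
  (c \in a :: route T k a b) = head_of T c && ((k == a) || (c != k)).
Proof.
move=> Ta Tb H; rewrite inE mem_rcons inE !mem_filter.
have [->|ca] := eqVneq c a.
  by rewrite Ta; case: H => [->|[/negbTE]]; rewrite ?eqxx // eq_sym => ->.
have [->|cb] := eqVneq c b.
  rewrite Tb /=; case: H => [->|[_ /negbTE]]; rewrite ?eqxx // eq_sym => ->.
  by rewrite orbT.
rewrite /=; case Tc: (head_of T c) => /=; last by rewrite andbF.
have /andP[-> _] := Tc; rewrite andbT.
by case: H => [->|[/negbTE-> _]] //; rewrite eqxx.
Qed.

Lemma laceable_step T : sorted ltn T -> 4 < size T -> 3 < size (heads T) ->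
  (forall k, head_of T k -> laceable (rem k T)) -> laceable T.
Proof.
move=> sT T4 h4 H x y xT yT xy.
have T0 : 0 < size T by apply: leq_trans T4.
have uT : uniq T by apply: (sorted_uniq ltn_trans ltnn).
have [k [x' [Ex Tk x'T]]] := lin_ext_head T0 xT.
have [l [y' [Ey Tl y'T]]] := lin_ext_head T0 yT.
subst x y.
(* Endpoints in different blocks: one chain through all blocks. *)
have [kl|kl] := eqVneq k l; last first.
  have Mks c : (c \in k :: route T k k l) = head_of T c.
    by rewrite mem_route // ?eqxx ?andbT //; left.
  have uks := route_uniq k uT kl.
  have [|||| p [hp Hp]] :=
    @block_chain T k (route T k k l) (k :: x') (l :: y') sT T4 uks.
  - by move=> c; rewrite Mks => Tc; split=> //; apply: H.
  - by rewrite !inE eqxx andbT.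
  - by rewrite !inE last_rcons eqxx andbT.
  - by [].
  exists p; split.
    apply: ham_eq hp => w; rewrite inE Mks; case wT: (w \in lin_ext T) => //=.
    by have [c [w' [-> ->]]] := lin_ext_head T0 wT.
  apply: Hp; apply: every_other_2_short => //.
  have : perm_eq (k :: route T k k l) (heads T).
    apply: (uniq_perm uks) => [|c]; first exact: filter_uniq.
    by rewrite Mks mem_filter /head_of; case: (c \in T); rewrite ?andbT.
  by move/perm_size => /= E; rewrite -ltnS [X in _ < X]E.
(* Endpoints in the same block: a path of the block is opened at an edge whose first letters [a] and
   [b] differ and are not 2. *)
subst l.
have [q [hq Hq]] := H k Tk x' y' x'T y'T (etrans (esym (lin_ext_odd_inv k x'T y'T)) xy).
have [p1 [v [p2 [Eq]]]] := path_split Hq.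
set u := last x' p1 => Kuv.
have uV : u \in lin_ext (rem k T).
  by have [_ _ _ <-] := hq; rewrite Eq -cat_cons mem_cat mem_last.
have vV : v \in lin_ext (rem k T).
  by have [_ _ _ <-] := hq; rewrite Eq inE mem_cat mem_head !orbT.
have uv : adj u v.
  by have [] := hq; rewrite Eq cat_path /= => /and3P[].
have [huv] : head 0 u != head 0 v /\ (head 0 u != 2) && (head 0 v != 2).
  by move: Kuv; rewrite !negb_or => /and3P[-> -> ->].
have [a [b [w [ab Eu Ev]]]] := adj_head uv huv.
rewrite Eu Ev /= => /andP[a2 b2].
have letter c z : c :: z \in lin_ext (rem k T) -> c != 2 -> [/\ head_of T c & k != c].
  rewrite lin_ext_cons => /andP[/andP[cT _] _] c2.
  rewrite /head_of (negbTE c2) (mem_rem cT).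
  by split=> //; apply: contraTN cT => /eqP<-; rewrite mem_rem_uniq // inE eqxx.
have [Ta ka] : [/\ head_of T a & k != a].
  by apply: (letter a (b :: w)) => //; rewrite -Eu.
have [Tb kb] : [/\ head_of T b & k != b].
  by apply: (letter b (a :: w)) => //; rewrite -Ev.
(* Moving [k] behind [c] cannot put 2 in front of 1, as [c] is not 2. *)
have lift c z : c :: z \in lin_ext (rem k T) -> c != 2 -> head_of T c ->
    k != c -> c :: k :: z \in lin_ext T.
  move=> cV c2 Tc kc.
  have kV : [:: k, c & z] \in lin_ext T by rewrite lin_ext_cons Tk cV.
  apply: lin_ext_perm (kV); first by apply: adj_perm; apply: adj_swap.
  apply: one_first_swap; first by rewrite (negbTE c2) andbF.
  by case/andP: kV.
have aV : [:: a, k, b & w] \in lin_ext T by apply: lift; rewrite -?Eu.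
have bV : [:: b, k, a & w] \in lin_ext T by apply: lift; rewrite -?Ev.
have Mks c : (c \in a :: route T k a b) = head_of T c && (c != k).
  by rewrite mem_route // ?(negbTE ka) //; right.
have A1 : adj (k :: u) [:: a, k, b & w] by rewrite Eu adj_swap.
have A2 : adj [:: b, k, a & w] (k :: v) by rewrite Ev adj_swap // eq_sym.
have [|||| r [hr Hr]] := @block_chain T a (route T k a b) _ _ sT T4
   (route_uniq k uT ab) _ (_ : [:: a, k, b & w] \in _) (_ : [:: b, k, a & w] \in _).
- by move=> c; rewrite Mks => /andP[Tc _]; split=> //; apply: H.
- by rewrite inE aV /= eqxx.
- by rewrite inE bV last_rcons /= eqxx.
(* Three interchanges lead from a k b w over k a b w and k b a w to b k a w, so the parities are
   opposite. *)
- have := adj_odd_inv uv; have := adj_odd_inv A1; have := adj_odd_inv A2.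
  rewrite adj_sym in A2; rewrite (adj_odd_inv A1) (adj_odd_inv A2).
  have : odd_inv (k :: v) = ~~ odd_inv (k :: u) by apply: adj_odd_inv; rewrite adj_cons.
  by move=> -> _ _ _; case: (odd_inv _).
have hk := ham_block Tk hq; rewrite Eq map_cat /= in hk.
have D z : z \in block T k ->
    z \notin [pred w0 | (w0 \in lin_ext T) && (head 0 w0 \in a :: route T k a b)].
  by rewrite [z \in block _ _]inE => /andP[_ /eqP E]; rewrite inE E Mks eqxx !andbF.
have A1' : adj (last (k :: x') (map (cons k) p1)) [:: a, k, b & w] by rewrite last_map.
exists (map (cons k) p1 ++ [:: a, k, b & w] :: r ++ (k :: v) :: map (cons k) p2); split.
  apply: ham_eq (ham_insert D A1' A2 hk hr) => z.
  rewrite -[LHS]/(((z \in lin_ext T) && (head 0 z == k)) ||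
    ((z \in lin_ext T) && (head 0 z \in a :: route T k a b))) Mks.
  case zT: (z \in lin_ext T) => //=.
  by have [c [z' [-> Tc _]]] := lin_ext_head T0 zT; rewrite /= Tc; case: (c == k).
(* If [k] is not 2, the edge entering the detour is a switch. If k = 2, the detour avoids block 2,
   so its chain of blocks contains a switch. *)
have [k2|k2] := eqVneq k 2; last first.
  by apply: switches_cat; rewrite last_map -/u Eu /same_head /= !negb_or ka k2 a2.
apply: switches_catr; apply: switches_catl; apply: Hr.
rewrite /every_other_2 /route; case E: (filter _ _) => [|c s] /=.
  by rewrite (negbTE a2) (negbTE b2).
have : c \in [seq c <- heads T | [&& c != a, c != b & c != k]] by rewrite E mem_head.
by rewrite mem_filter k2 => /andP[/and3P[_ _ /negbTE->] _]; rewrite (negbTE a2).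
Qed.

(** * Reversing and relabelling Hamiltonian paths *)

Lemma switches_rev q x p : switches q (last x p) (rev (belast x p)) = switches q x p.
Proof.
rewrite /switches rev_path; congr (~~ _); apply: eq_path => u v.
by rewrite /same_head eq_sym [(head 0 v == q) || _]orbC.
Qed.

Lemma ham_rev S x y p : ham_path S x y p -> ham_path S y x (rev (belast x p)).
Proof.
move=> [adjp <- uniqp Ep].
have E : last x p :: rev (belast x p) = rev (x :: p) by rewrite [in RHS]lastI rev_rcons.
split; last 2 first.
- by rewrite E rev_uniq.
- by move=> w; rewrite E mem_rev.
- by rewrite rev_path (eq_path (e' := adj)) // => u v; rewrite adj_sym.
- by case: p {adjp uniqp Ep E} => //= a p; rewrite rev_cons last_rcons.
Qed.

(** Paths can be read backwards, so only those from an even to an odd word have to be found. *)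
Lemma laceable_even T :
    (forall x y, x \in lin_ext T -> y \in lin_ext T -> ~~ odd_inv x -> odd_inv y ->
      exists p, ham_path (lin_ext T) x y p /\ switches 2 x p) -> laceable T.
Proof.
move=> H x y xT yT; case px: (odd_inv x); case py: (odd_inv y) => // _; last first.
  by apply: H; rewrite ?px ?py.
have [||p [hp Hp]] := H y x yT xT; rewrite ?px ?py //.
exists (rev (belast y p)); split; first exact: ham_rev.
by have [_ <- _ _] := hp; rewrite switches_rev.
Qed.

Lemma odd_inv_map f (T w : word) :
  {in T &, {mono f : a b / a < b}} -> {subset w <= T} ->
  odd_inv (map f w) = odd_inv w.
Proof.
move=> mf; elim: w => //= a w IH aw.
have wT : {subset w <= T} by move=> b bw; apply: aw; rewrite inE bw orbT.
rewrite IH // count_map; congr (odd _ (+) _); apply: eq_in_count => b bw /=.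
by apply: mf; [exact: wT | exact: aw (mem_head _ _)].
Qed.

Definition words (P : pred word) T := [seq w <- permutations T | P w].

(** The form of laceability that is computed; [q] marks the letter, if any, that a relabelling sends
    to 2. *)
Definition laced q (P : pred word) T := forall x y,
  x \in words P T -> y \in words P T -> ~~ odd_inv x -> odd_inv y ->
  exists p, ham_path (mem (words P T)) x y p /\ switches q x p.

(* Monotone relabelling preserves inversions, so parities agree on both sides; for
   this reason the alphabets are kept sorted throughout. *)
Lemma laceable_relabel f q (P : pred word) (T : word) : 0 < size T ->
    {in T &, {mono f : a b / a < b}} ->
    {in T, forall a, (f a == 2) = (a == q)} ->
    (forall w, perm_eq w T -> one_first (map f w) = P w) ->
  laced q P T -> laceable (map f T).
Proof.
move=> T0 mf fq fP L; apply: laceable_even.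
have fI : {in T &, injective f}.
  move=> a b aT bT E; move: (mf a b aT bT) (mf b a bT aT).
  by rewrite E ltnn; case: ltngtP.
have Wsub w : w \in words P T -> {subset w <= T}.
  by rewrite mem_filter mem_permutations => /andP[_ /perm_mem E] a; rewrite E.
have WP w : w \in words P T -> perm_eq w T.
  by rewrite mem_filter mem_permutations => /andP[].
have surj x : x \in lin_ext (map f T) -> exists2 w, w \in words P T & x = map f w.
  move=> /andP[xT okx].
  pose g c := nth 0 T (index c (map f T)).
  have gK : {in T, cancel f g}.
    move=> a aT; rewrite /g; set i := index _ _.
    have iT : i < size T by rewrite -(size_map f) index_mem map_f.
    apply: fI; rewrite ?mem_nth // -(nth_map _ 0) //.
    by rewrite nth_index // map_f.
  have gfT : map g (map f T) = T by rewrite -map_comp -[RHS]map_id; apply/eq_in_map.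
  have xE : x = map f (map g x).
    rewrite -map_comp -[LHS]map_id; apply/eq_in_map => c.
    by rewrite (perm_mem xT) => /mapP[a aT ->] /=; rewrite gK.
  have wT : perm_eq (map g x) T by rewrite -[X in perm_eq _ X]gfT perm_map.
  exists (map g x) => //.
  by rewrite mem_filter mem_permutations wT andbT -fP // -xE.
have inV w : w \in words P T -> map f w \in lin_ext (map f T).
  rewrite mem_filter mem_permutations => /andP[Pw wT].
  by rewrite inE perm_map //= fP.
have mapI : {in words P T &, injective (map f)}.
  move=> u v /Wsub uT /Wsub vT.
  elim: u v uT vT => [|a u IH] [|b v] //= uT vT [E /IH->].
  - by rewrite (fI a b (uT a (mem_head _ _)) (vT b (mem_head _ _)) E).
  - by move=> c cu; apply: uT; rewrite inE cu orbT.
  - by move=> c cv; apply: vT; rewrite inE cv orbT.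
move=> _ _ /surj[x xW ->] /surj[y yW ->].
rewrite !(odd_inv_map mf (Wsub _ _)) // => px py.
have [p [[adjp lastp uniqp Ep] Hp]] := L x y xW yW px py.
have allW : all (mem (words P T)) (x :: p) by apply/allP => w; rewrite Ep.
exists (map (map f) p); split; first split.
- apply: (homo_path_in _ allW adjp) => u v uW vW /adjP[s [a [b [t [ab Eu Ev]]]]].
  apply/adjP; exists (map f s), (f a), (f b), (map f t).
  rewrite Eu Ev !map_cat; split=> //.
  apply: contra ab => /eqP /fI-> //; apply: (Wsub u uW);
    by rewrite Eu mem_cat !inE eqxx !orbT.
- by rewrite last_map lastp.
- rewrite -map_cons map_inj_in_uniq // => u v uW vW; apply: mapI.
  + by rewrite -[_ \in _]Ep.
  + by rewrite -[_ \in _]Ep.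
- move=> w; rewrite -map_cons; apply/mapP/idP => [[z]|/surj[z zW ->]].
    by rewrite Ep => zW ->; apply: inV.
  by exists z => //; rewrite Ep.
rewrite /switches (mono_path_in (e := same_head q) _ allW) // => u v.
have hd w : w \in words P T -> head 0 w \in T /\ head 0 (map f w) = f (head 0 w).
  move=> wW; case: w wW (Wsub _ wW) => [/WP/perm_size E|a w _ ->] //;
    last exact: mem_head.
  by rewrite -E in T0.
move=> /hd[uT Eu] /hd[vT Ev]; rewrite /same_head Eu Ev !fq //; congr [|| _, _ | _].
by apply/eqP/eqP => [/fI->|->].
Qed.

(** * Base cases by verified computation *)

Fixpoint swap (i : nat) (w : word) :=
  match i, w with
  | 0, a :: b :: w' => b :: a :: w'
  | i'.+1, a :: w' => a :: swap i' w'
  | _, _ => w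
  end.

(** Paths are stored as lists of positions: entry i interchanges the letters at positions i and
    i+1. *)
Definition walk (x : word) (c : seq nat) := scanl (fun w i => swap i w) x c.

Definition check_path (qs : seq nat) (W : seq word) x y c :=
  let p := walk x c in
  [&& path adj x p, last x p == y, uniq (x :: p), size (x :: p) == size W,
      all (mem W) p & all (fun q => switches q x p) qs].

Definition check_table qs W table :=
  all2 (fun x => all2 (check_path qs W x) [seq y <- W | odd_inv y])
    [seq x <- W | ~~ odd_inv x] table.

Lemma all2_ex A B (r : A -> B -> bool) (s : seq A) t :
  all2 r s t -> forall P : pred A, has P s -> exists2 x, P x & exists y, r x y.
Proof.
elim: s t => [|a s IH] [|b t] //= /andP[ab st] P /orP[Pa|]; last exact: IH st P.
by exists a => //; exists b.
Qed.

Lemma check_tableP qs P T table q : check_table qs (words P T) table ->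
  q \in qs -> laced q P T.
Proof.
move=> tab qQ x y xW yW px py.
have xs : has (pred1 x) [seq x <- words P T | ~~ odd_inv x].
  by rewrite has_pred1 mem_filter px xW.
have ys : has (pred1 y) [seq y <- words P T | odd_inv y].
  by rewrite has_pred1 mem_filter py yW.
have [_ /eqP-> [row Hrow]] := all2_ex tab xs.
have [_ /eqP-> [c]] := all2_ex Hrow ys.
case/and5P; set p := walk x c => adjp /eqP lastp uniqp /eqP sz /andP[/allP pW /allP Hq].
exists p; split; last exact: Hq.
(* Distinct elements of [words P T], as many as it has, exhaust it. *)
split=> // w; have [|_ ->//] := uniq_min_size uniqp _ (eq_leq (esym sz)).
by move=> z; rewrite inE => /predU1P[->//|/pW].
Qed.

(* Posa rotations: if the first vertex of a Hamiltonian path is adjacent to the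
   one at position i, reversing the first i vertices gives another one. *)
Definition rotations (s : seq word) :=
  [seq rev (take i s) ++ drop i s
     | i <- iota 2 (size s - 2) & adj (head [::] s) (nth [::] s i)].

(* Keeping one path per pair of endpoints misses a few pairs; one path for each
   choice of the first two vertices and the last one reaches them all. *)
Definition search_key (s : seq word) :=
  foldr (fun a k => iter a xO (xI k)) xH
    (head [::] s ++ nth [::] s 1 ++ last [::] s).

(** Pushing [rev s] as well lets the rotations act at both ends of a path. *)
Fixpoint explore fuel seen (found todo : seq (seq word)) :=
  if fuel is fuel'.+1 then
    if todo is s :: todo' then
      let k := search_key s in
      if FMapPositive.PositiveMap.mem k seen
      then explore fuel' seen found todo'
      else explore fuel' (FMapPositive.PositiveMap.add k tt seen) (s :: found)
             (rev s :: rotations s ++ todo')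
    else found
  else found.

Definition swap_index (u v : word) :=
  find (fun ab : nat * nat => ab.1 != ab.2) (zip u v).

Definition swap_code (s : seq word) :=
  pairmap swap_index (head [::] s) (behead s).

(* Nothing is proved about the search: [check_table] verifies its output, and fails
   on the junk code [::] recorded for a pair without a path. *)
Definition path_table qs W x c :=
  let found := [seq s <- explore (2 ^ 15) (FMapPositive.PositiveMap.empty unit)
                           [::] [:: x :: walk x c]
                  | all (fun q => switches q (head [::] s) (behead s)) qs] in
  [seq let from_x := [seq s <- found | head [::] s == x] in
       [seq swap_code (nth [::] from_x (find (fun s => last [::] s == y) from_x))
          | y <- W & odd_inv y]
     | x <- W & ~~ odd_inv x].

(* The initial path is the Johnson-Trotter listing. *)
Definition table4 := Eval vm_compute in
  path_table (iota 0 5) (words predT (iota 0 4)) (iota 0 4)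
    [:: 2; 1; 0; 2; 0; 1; 2; 0; 2; 1; 0; 2; 0; 1; 2; 0; 2; 1; 0; 2; 0; 1; 2].

(** The initial path takes 59 interchanges to visit the 60 words. *)
Definition table5 := Eval vm_compute in
  path_table [:: 2] (words one_first (iota 1 5)) (iota 1 5)
    [:: 2; 3; 2; 3; 2; 1; 0; 3; 0; 2; 0; 1; 0; 1; 0; 2; 0; 3; 0; 2; 0; 1; 0; 1;
        0; 2; 0; 3; 0; 2; 0; 1; 0; 1; 0; 3; 0; 1; 0; 1; 0; 2; 0; 1; 0; 1; 0; 2;
        0; 1; 2; 1; 0; 1; 0; 1; 2; 1; 0].

Lemma laced4 q : q < 5 -> laced q predT (iota 0 4).
Proof.
move=> q5; apply: (@check_tableP (iota 0 5) _ _ table4); last by rewrite mem_iota.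
by vm_compute.
Qed.

Lemma laced5 : laced 2 one_first (iota 1 5).
Proof.
apply: (@check_tableP [:: 2] _ _ table5); last exact: mem_head.
by vm_compute.
Qed.

(** * Laceability by induction on the alphabet *)

Lemma laceable4 T : sorted ltn T -> 1 \notin T -> size T = 4 -> laceable T.
Proof.
move=> sT T1 szT.
have uT : uniq T by apply: (sorted_uniq ltn_trans ltnn).
have {1}-> : T = map (nth 0 T) (iota 0 4) by rewrite -szT map_nth_iota0 // take_size.
have inT a : a \in iota 0 4 = (a < size T) by rewrite mem_iota szT.
apply: (@laceable_relabel _ (index 2 T) predT) => //.
- move=> a b; rewrite !inT => aT bT.
  have [ab|ba|->] := ltngtP a b; last by rewrite ltnn.
  + exact: (sorted_ltn_nth ltn_trans) ab.
  + by apply/negbTE; rewrite -leqNgt ltnW //; apply: (sorted_ltn_nth ltn_trans) ba.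
- move=> a; rewrite inT => aT; apply/eqP/eqP => [<-|aE]; first by rewrite index_uniq.
  by rewrite aE nth_index // -index_mem -aE.
- move=> w wT; apply: contra T1 => /mem_subseq /(_ 1); rewrite !inE => /(_ isT).
  move=> /mapP[a]; rewrite (perm_mem wT) inT => aT ->; exact: mem_nth.
by apply: laced4; rewrite -szT ltnS index_size.
Qed.

Lemma one_first_map f w : {in w, forall a, (f a == 1) = (a == 1)} ->
  {in w, forall a, (f a == 2) = (a == 2)} -> one_first (map f w) = one_first w.
Proof.
elim: w => //= a w IH f1 f2.
have fw1 : {in w, forall a, (f a == 1) = (a == 1)}.
  by move=> b bw; apply: f1; rewrite inE bw orbT.
have [a2|a2] := eqVneq a 2; last first.
  rewrite !one_first_cons ?f2 ?mem_head //; apply: IH => // b bw.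
  by apply: f2; rewrite inE bw orbT.
have -> : f a = 2 by apply/eqP; rewrite f2 ?mem_head // a2.
rewrite a2 !one_first_cons2; congr (~~ _); apply/mapP/idP => [[b bw fb]|w1].
  by have := fw1 b bw; rewrite -fb eqxx => /esym/eqP <-.
by exists 1 => //; apply/esym/eqP; rewrite fw1.
Qed.

Lemma laceable5 T : sorted ltn T -> 0 \notin T -> 1 \in T -> 2 \in T ->
  size T = 5 -> laceable T.
Proof.
case: T => [|a [|b [|c [|d [|e [|]]]]]] //= sT T0 T1 T2 _.
have [a1 [b2 [c3 [cd de]]]] : a = 1 /\ b = 2 /\ 2 < c /\ c < d /\ d < e.
  by move: sT T0 T1 T2; rewrite !inE; lia.
rewrite {sT T0 T1 T2}a1 b2.
(* The 0 in front is padding, so that [nth] sends i to the i-th letter counted from 1 and fixes 1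
   and 2. *)
rewrite -[[:: 1; 2; c; d; e]]/(map (nth 0 [:: 0; 1; 2; c; d; e]) (iota 1 5)).
apply: (@laceable_relabel _ 2 one_first) laced5 => //.
- move=> x y; rewrite [iota _ _]/= !inE.
  by move=> /or4P[||| /orP[]] /eqP-> /or4P[||| /orP[]] /eqP-> /=; lia.
- by move=> x; rewrite [iota _ _]/= !inE => /or4P[||| /orP[]] /eqP-> /=; lia.
- by move=> w wT; apply: one_first_map => x; rewrite (perm_mem wT) [iota _ _]/= !inE;
    move=> /or4P[||| /orP[]] /eqP-> /=; lia.
Qed.

(** Deleting a head never removes 2 before 1, and excluding 0 makes 1 and 2 the two smallest
    letters, as [laceable5] needs. Deleting 1 lowers the size bound from 5 to 4, so the bound
    survives. *)
Lemma laceable_sorted T : sorted ltn T -> 0 \notin T -> (1 \in T -> 2 \in T) ->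
  4 + (1 \in T) <= size T -> laceable T.
Proof.
move: {2}(size T) (leqnn (size T)) => n; elim: n T => [|n IH] T.
  by rewrite leqn0 => /eqP->; rewrite addSn.
move=> Tn sT T0 T12 szT.
have uT : uniq T by apply: (sorted_uniq ltn_trans ltnn).
have IHr k : head_of T k -> (k != 1 -> 5 + (1 \in T) <= size T) -> laceable (rem k T).
  move=> /andP[kT k2] szk.
  have szr : size (rem k T) = (size T).-1 by rewrite size_rem.
  apply: IH; rewrite ?sorted_rem ?szr //.
  - by move: Tn szT; lia.
  - by rewrite mem_rem_uniq // inE negb_and T0 orbT.
  - rewrite !mem_rem_uniq // !inE => /andP[_ T1]; rewrite T12 // andbT.
    by move: k2; rewrite T1 andbT eq_sym.
  - rewrite mem_rem_uniq // inE; have [E|k1] := eqVneq k 1.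
      by move: szT; rewrite -E kT; lia.
    by have := szk k1; case: (1 \in T) => /=; lia.
have [T1|T1] := boolP (1 \in T); rewrite ?T1 ?(negbTE T1) in szT IHr.
  have [T5|T5] := eqVneq (size T) 5; first by apply: laceable5 => //; apply: T12.
  have T6 : 5 < size T by rewrite ltn_neqAle eq_sym T5.
  have hT : heads T = rem 2 T.
    rewrite rem_filter //; apply: eq_in_filter => c cT.
    by rewrite /head_of cT T1 andbT.
  apply: laceable_step => // [|k kT].
    by rewrite hT size_rem ?T12 // -ltnS prednK ?(ltnW T6) // (ltn_trans _ T6).
  by apply: IHr => // _; rewrite T1.
have [T4|T4] := eqVneq (size T) 4; first exact: laceable4.
have T5 : 4 < size T by rewrite ltn_neqAle eq_sym T4.
have hT : heads T = T.
  by apply/all_filterP/allP => c cT; rewrite /head_of cT (negbTE T1) andbF.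
apply: laceable_step => // [|k kT]; first by rewrite hT ltnW.
by apply: IHr => // _; rewrite (negbTE T1).
Qed.

(** * From half a listing to a reverse Gray code *)

Lemma adj_interchangeP w w' : uniq w -> adj_interchange w w' <-> adj w w'.
Proof.
move=> uw; split=> [[j [jw ->]]|/adjP[s [a [b [t [ab -> ->]]]]]].
  elim: j w uw jw => [|j IH] [|a [|b w]] // uw jw.
    (* Uniqueness makes the two letters differ, as [adj] requires. *)
    apply: adj_swap; move: uw; rewrite /= inE negb_or -!andbA.
    by case/andP.
  by have := IH (b :: w); rewrite -(adj_cons a); apply=> //; case/andP: uw.
exists (size s); split; first by rewrite size_cat /=; lia.
by elim: s => //= c s <-.
Qed.

Lemma odd_inv_rcons w a : odd_inv (rcons w a) = odd (count (ltn a) w) (+) odd_inv w.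
Proof.
elim: w => //= c w IH; rewrite IH -cats1 count_cat /= addn0 !oddD.
case: ltnP => ac /=; rewrite ?addn0;
  by case: (odd (count _ _)); case: (odd (count _ _)); case: (odd_inv w).
Qed.

(** Every pair of letters is an inversion of exactly one of [w] and [rev w]. *)
Lemma odd_inv_rev w : uniq w -> odd_inv (rev w) = odd 'C(size w, 2) (+) odd_inv w.
Proof.
elim: w => //= a w IH /andP[aw uw].
have E : count (ltn a) w + count (fun b => b < a) w = size w.
  rewrite -(count_predC (ltn a) w); congr (_ + _); apply: eq_in_count => b bw /=.
  by rewrite -leqNgt ltn_neqAle; case: eqP bw aw => // -> ->.
rewrite rev_cons odd_inv_rcons count_rev IH // binS bin1 oddD -{3}E oddD.
by case: (odd 'C(_, _)); case: (odd (count _ _)); case: (odd (count _ _));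
  case: (odd_inv w).
Qed.

Lemma odd_bin2 n : odd 'C(n, 2) = (n %% 4 == 2) || (n %% 4 == 3).
Proof.
elim: n => // n IH; rewrite binS bin1 oddD IH.
by have := ltn_pmod n (isT : 0 < 4); lia.
Qed.

(** Reversal preserves adjacency, so the reversed half is again a path; the middle step goes from
    [last x p] to [rev x]. *)
Lemma gray_of_half n x p :
    path adj x p -> adj (last x p) (rev x) -> uniq (x :: p ++ map rev (x :: p)) ->
    x :: p ++ map rev (x :: p) =i permutations (iota 1 n) ->
  reverse_gray_code n (x :: p ++ map rev (x :: p)).
Proof.
set L := x :: _ => adjp adjl uL LE.
have PL : perm_eq L (permutations (iota 1 n)).
  by apply: uniq_perm => //; apply: permutations_uniq.
have szL : size L = n`!.
  by rewrite (perm_size PL) size_permutations ?iota_uniq // size_iota.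
have szh : n`! %/ 2 = size (x :: p).
  by rewrite -szL /L -cat_cons size_cat size_map addnn -muln2 mulnK.
have adjL : path adj x (p ++ map rev (x :: p)).
  rewrite cat_path adjp /= adjl /=; apply: homo_path adjp => u v; exact: adj_rev.
split=> //.
- by move=> w; rewrite LE mem_permutations.
- move=> i iL; apply/adj_interchangeP.
    have : nth [::] L i \in L by rewrite mem_nth // ltnW.
    by rewrite LE mem_permutations => /perm_uniq->; rewrite iota_uniq.
  exact: (pathP [::] adjL).
- move=> i; rewrite szh => ip; rewrite /L -cat_cons !nth_cat ip.
  by rewrite ifF ?addnK ?(nth_map [::]) // ltnNge leq_addl.
Qed.

Lemma subseq2_rev (a b : nat) w : uniq w -> a \in w -> b \in w -> a != b ->
  subseq [:: a; b] w = ~~ subseq [:: b; a] w.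
Proof.
elim: w => // c w IH /= /andP[cw uw].
have nocc s : c \in s -> subseq s w = false.
  by move=> cs; apply: contraNF cw => /mem_subseq; apply.
have [->|ac] := eqVneq a c.
  rewrite mem_head => _ + cb; rewrite inE eq_sym (negbTE cb) /= => bw.
  by rewrite sub1seq bw nocc // !inE eqxx orbT.
have [->|bc] := eqVneq b c.
  by rewrite inE (negbTE ac) /= => aw _ _; rewrite sub1seq aw nocc // !inE eqxx orbT.
by rewrite !inE (negbTE ac) (negbTE bc); apply: IH.
Qed.

Lemma one_first_rev n w : 1 < n -> perm_eq w (iota 1 n) ->
  one_first (rev w) = ~~ one_first w.
Proof.
move=> n1 wn; have uw : uniq w by rewrite (perm_uniq wn) iota_uniq.
rewrite /one_first -[[:: 2; 1]]/(rev [:: 1; 2]) subseq_rev subseq2_rev //.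
all: by rewrite (perm_mem wn) mem_iota; lia.
Qed.

Lemma gray_of_laceable n : 1 < n -> ~~ odd 'C(n, 2) -> laceable (iota 1 n) ->
  exists L, reverse_gray_code n L.
Proof.
case: n => [|[|n]] // _ nC L.
set x := iota 1 n.+2; pose r := rev (iota 3 n).
have Ex : rev x = r ++ [:: 2; 1].
  by rewrite /x -[iota 1 n.+2]/([:: 1; 2] ++ iota 3 n) rev_cat.
have ux : uniq x by rewrite iota_uniq.
have okx : one_first x by apply: sorted_one_first; apply: iota_ltn_sorted.
(* The first half is to end at [rev x] with its last two letters interchanged. *)
have A : adj (r ++ [:: 1; 2]) (rev x) by rewrite Ex; apply/adjP; exists r, 1, 2, [::].
have pv : perm_eq (rev x) x by rewrite perm_rev.
have [||| p [[adjp lastp uniqp Ep] _]] := L x (r ++ [:: 1; 2]).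
- by rewrite inE perm_refl.
- rewrite inE (perm_trans (adj_perm A)) //=.
  rewrite /one_first -[[:: 2; 1]]/(rev [:: 1; 2]) -[r ++ _]revK subseq_rev.
  rewrite rev_cat /r revK /=.
  by rewrite sub1seq mem_iota.
(* As ['C(n.+2, 2)] is even, [rev x] has the parity of [x], and its neighbour the opposite one. *)
- have := adj_odd_inv A; rewrite odd_inv_rev // size_iota (negbTE nC) addFb => ->.
  by case: (odd_inv _).
exists (x :: p ++ map rev (x :: p)); apply: gray_of_half => //.
- by rewrite lastp.
- rewrite -cat_cons cat_uniq uniqp (map_inj_uniq (can_inj revK)) uniqp andbT andTb.
  apply/hasPn => _ /mapP[w + ->]; rewrite Ep => /andP[wx okw]; rewrite Ep inE.
  by rewrite (@one_first_rev n.+2) // okw andbF.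
move=> w; have Er : (w \in map rev (x :: p)) = (rev w \in lin_ext x).
  by rewrite -[in LHS](revK w) (mem_map (can_inj revK)) Ep.
rewrite -cat_cons mem_cat Ep Er mem_permutations -/x !inE perm_rev.
case wx: (perm_eq w x) => //=; rewrite (@one_first_rev n.+2) //; exact: orbN.
Qed.

Theorem theorem7 (n : nat) : 1 <= n ->
  (exists L : seq (seq nat), reverse_gray_code n L) <->
  (n <= 4 \/ n %% 4 = 0 \/ n %% 4 = 1).
Proof.
move=> n0; split=> [[L [szL uL memL adjL revL]]|H].
  have [n4|n4] := leqP n 4; [by left | right].
  (* Since 4! divides n!, the half n!/2 is a multiple of 4, in particular even. *)
  have n8 : 8 %| n`! by rewrite -(bin_fact (ltnW n4)) dvdn_mull // dvdn_mulr.
  set h := n`! %/ 2 in revL.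
  have Eh : n`! = 4 * (n`! %/ 8) * 2 by lia.
  have h0 : 0 < h by have := fact_gt0 n; rewrite /h; lia.
  have hn : h < size L by rewrite szL /h; lia.
  have parL i : i < size L -> odd_inv (nth [::] L i) = odd i (+) odd_inv (nth [::] L 0).
    elim: i => // i IH iL; have iL' := ltnW iL.
    have ui : uniq (nth [::] L i).
      by have /memL/perm_uniq-> := mem_nth [::] iL'; rewrite iota_uniq.
    have /(adj_interchangeP _ ui)/adj_odd_inv -> := adjL i iL.
    by rewrite IH //= addNb.
  have L0 := mem_nth [::] (leq_ltn_trans (leq0n h) hn).
  have u0 : uniq (nth [::] L 0) by have /memL/perm_uniq-> := L0; rewrite iota_uniq.
  have s0 : size (nth [::] L 0) = n by have /memL/perm_size-> := L0; rewrite size_iota.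
  (* The word at position [h] is an even number of steps from the first one and is its reversal, so
     ['C(n, 2)] is even. *)
  have := parL h hn; rewrite -[h]add0n revL // odd_inv_rev // s0 add0n odd_bin2.
  have -> : odd h = false by rewrite /h Eh mulnK // oddM.
  by have := ltn_pmod n (isT : 0 < 4); case: (odd_inv _) => /=; lia.
have [n4|n4] := leqP n 4; last first.
  apply: gray_of_laceable; first by apply: leq_trans n4.
    by rewrite odd_bin2; lia.
  apply: laceable_sorted; first exact: iota_ltn_sorted.
  - by rewrite mem_iota.
  - by rewrite !mem_iota; lia.
  by rewrite size_iota mem_iota; lia.
(* For n = 1 the half length is 0, so no reversal is demanded; for n = 2, 3, 4 the first 1, 3, 12
   words are given explicitly. *)
case: n n0 n4 {H} => [|[|[|[|[|]]]]] // _ _.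
- exists [:: [:: 1]]; split=> // w; rewrite inE /is_perm_word; split=> [/eqP->//|].
  by move/perm_small_eq => ->.
- by exists [:: [:: 1; 2]; [:: 2; 1]]; apply: (@gray_of_half 2 [:: 1; 2] [::]).
- pose p := walk (iota 1 3) [:: 1; 0].
  exists (iota 1 3 :: p ++ map rev (iota 1 3 :: p)).
  by apply: (@gray_of_half 3 _ p) => //; apply: perm_mem.
- pose p := walk (iota 1 4) [:: 0; 1; 0; 1; 2; 1; 2; 1; 0; 1; 0].
  exists (iota 1 4 :: p ++ map rev (iota 1 4 :: p)).
  by apply: (@gray_of_half 4 _ p) => //; apply: perm_mem.
Qed.
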